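(* Let $n_1,n_2,\ldots\ge 1$ be fixed integers, $N_t=n_1+\cdots+n_t$ (so $N_0=0$), and let $\theta=1$, so that the multiset permutation at step $t$ of the multiset Chinese restaurant process is uniformly random over the permutations of $M(n_1,\ldots,n_t)$. Then the number of cycles $K_t$ of this permutation has distribution given by the sum of independent negative hypergeometric distributed random variables, in the following form. Let $X_t$ be the number of new cycles added in moving from step $t-1$ to step $t$, $t\ge 1$. Then $K_t=\sum_{s=1}^t X_s$, the $X_t$ are independent, and for $k_t\in\{0,1,\ldots,n_t\}$, $$\mathbb{P}(X_t=k_t)=\frac{1}{\binom{N_t}{n_t}}\binom{N_{t-1}-1+n_t-k_t}{n_t-k_t}=\frac{\binom{n_t}{k_t}}{\binom{N_t}{k_t}}\,\frac{N_t-n_t}{N_t-k_t}.$$ Moreover $Y_t=X_t+1$ has the negative hypergeometric distribution with parameters $N=N_t$, $M=N_t-n_t=N_{t-1}$ and $r=1$.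
   Context: **Multiset permutations.** $M(n_1,\ldots,n_t)$ is the multiset containing $n_i$ copies of $i$ for each $i\in\{1,\ldots,t\}$ (and is empty for $t=0$). Elements are ordered as integers. A permutation of a multiset is an arrangement of its elements in a row. In two-line notation, a permutation has as its top line the elements of the multiset in nondecreasing order and as its bottom line the arrangement. **Intercalation product.** For permutations $\pi_1,\pi_2$ of two multisets, $\pi_1\top\pi_2$ is the permutation obtained by juxtaposing the two-line notations of $\pi_1$ and $\pi_2$ (with $\pi_1$ on the left) and stably sorting the columns into nondecreasing order of the top line (columns with equal top entries keep their left-to-right order). **Cycles.** For possibly repeated elements $x_1,\ldots,x_m$, the cycle $(x_1\,x_2\ldots x_m)$ is the multiset permutation obtained by stably sorting by top entry the columns of the two-line array with top line $x_1,x_2,\ldots,x_m$ and bottom line $x_2,x_3,\ldots,x_m,x_1$. **Cycle factorisation (known theorem of Knuth).** Every (nonempty) multiset permutation $\pi$ has a unique representation $$\pi=(x_{1,1}\ldots x_{1,m_1}\,y_1)\top(x_{2,1}\ldots x_{2,m_2}\,y_2)\top\cdots\top(x_{\tau,1}\ldots x_{\tau,m_\tau}\,y_\tau),\qquad \tau\ge 1,$$ with $y_1\le y_2\le\cdots\le y_\tau$ and $y_i<x_{i,j}$ for all $1\le j\le m_i$, $1\le i\le\tau$. The number of cycles of $\pi$ is $|\pi|=\tau$. **Multiset Chinese restaurant process with $\theta=1$.** Start from the empty permutation at step $0$. At step $t\ge 1$, given a permutation of $M(n_1,\ldots,n_{t-1})$ written in the factorised form above, some number $k_t\in\{0,1,\ldots,n_t\}$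 of the $n_t$ copies of $t$ start $k_t$ new singleton cycles $(t)$, and the other $n_t-k_t$ copies are inserted to the left of elements of the existing factorised permutation; there are $\binom{N_{t-1}-1+n_t-k_t}{n_t-k_t}$ ways of inserting them, and each specified choice of $k_t$ and of the insertion has probability $1/\binom{N_t}{n_t}$. **Convention.** $\binom{-1}{0}=1$ and $\binom{-1}{k}=0$ for $k\ge 1$. **Negative hypergeometric distribution** with parameters $N,M,r$: there are $N$ balls, $M$ representing successes and $N-M$ representing failures, drawn without replacement; the distribution gives the probability that the $r$th success happens on the $\kappa$th draw, with probability mass function $$\mathbb{P}(Y=\kappa)=\frac{\binom{M}{r-1}\binom{N-M}{\kappa-r}}{\binom{N}{\kappa-1}}\cdot\frac{M-r+1}{N-\kappa+1},\qquad \kappa=r,r+1,\ldots,N.$$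
   Formalization: The second formula for P(X_t=k_t) is claimed only for k_t<N_t (at t=1, k_1=n_1 it reads 0/0); Y_t is claimed to have the full negative hypergeometric law only for t≥2, since Y_1=N_1+1 lies outside 1..N_1; for t=1 only the mass-function identity on 1..N_1 is claimed. *)

(* Defs.v *)
From HB Require Import structures.
From mathcomp Require Import all_boot all_order all_algebra.
From mathcomp Require Import finmap.
From mathcomp Require Import all_classical all_reals all_analysis.

Set Implicit Arguments.
Unset Strict Implicit.
Unset Printing Implicit Defensive.

Import Order.TTheory GRing.Theory Num.Theory.

Local Open Scope classical_set_scope.
Local Open Scope nat_scope.

(* A permutation in two-line notation: its columns (top, bottom), listed from
   left to right. *)
Definition two_line := seq (nat * nat).

(* [sort] is a stable merge sort. *)
Definition sort_columns (a : two_line) : two_line :=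
  sort (fun c d => c.1 <= d.1) a.

Definition intercalation (p q : two_line) : two_line := sort_columns (p ++ q).

Definition cycle_perm (c : seq nat) : two_line := sort_columns (zip c (rot 1 c)).

Definition cycles_product (cs : seq (seq nat)) : two_line :=
  foldr intercalation [::] (map cycle_perm cs).

(* The word [x_1; ..; x_m; y] with y < x_j for all j; m = 0 is allowed. *)
Definition canonical_cycle (c : seq nat) : bool :=
  (c != [::]) && all (fun x => last 0 c < x) (take (size c).-1 c).

Definition canonical_factors (cs : seq (seq nat)) : bool :=
  all canonical_cycle cs && sorted leq (map (last 0) cs).

(* By Knuth's theorem every multiset permutation p has exactly one family of
   canonical factors with product p, so that [xget] selects that one. For the
   empty permutation it is the empty family. *)
Definition cycle_factors (p : two_line) : seq (seq nat) :=
  xget [::] [set cs | canonical_factors cs /\ cycles_product cs = p].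

Definition num_cycles (p : two_line) : nat := size (cycle_factors p).

Definition partial_sum (n : nat -> nat) (t : nat) : nat :=
  \sum_(1 <= s < t.+1) n s.

(* The multiset M(n_1, .., n_t), in nondecreasing order. *)
Definition multiset (n : nat -> nat) (t : nat) : seq nat :=
  flatten [seq nseq (n s) s | s <- iota 1 t].

(* All permutations of M(n_1, .., n_t), without repetition. *)
Definition multiset_perms (n : nat -> nat) (t : nat) : seq two_line :=
  [seq zip (multiset n t) w | w <- permutations (multiset n t)].

(* A choice (k, m) at step t: k copies of t start new singleton cycles, and
   m_i copies of t are inserted immediately to the left of the i-th of the
   N_{t-1} elements of the factorised permutation (read from left to right). *)
Definition valid_choice (n : nat -> nat) (t : nat) (c : nat * seq nat) : bool :=
  (size c.2 == partial_sum n t.-1) && (c.1 + sumn c.2 == n t).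

Definition insert_in_cycle (t : nat) (m : seq nat) (c : seq nat) : seq nat :=
  flatten [seq rcons (nseq mx.1 t) mx.2 | mx <- zip m c].

(* [reshape] cuts the list of multiplicities into one list per cycle. *)
Definition insert_in_factors (t : nat) (c : nat * seq nat)
    (cs : seq (seq nat)) : seq (seq nat) :=
  [seq insert_in_cycle t mc.1 mc.2 | mc <- zip (reshape (shape cs) c.2) cs]
  ++ nseq c.1 [:: t].

Definition crp_step (t : nat) (c : nat * seq nat) (p : two_line) : two_line :=
  cycles_product (insert_in_factors t c (cycle_factors p)).

(* The process with theta = 1: [Pi t] is the permutation at step t and [C t]
   (for t >= 1) the choice that produces it from [Pi t.-1]. The last field says
   that, conditionally on the permutations up to step t, each valid choice at
   step t + 1 has probability 1 / binom(N_{t+1}, n_{t+1}); it is written as a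
   product so as to cover histories of probability zero. *)
Record multiset_crp (d : measure_display) (T : measurableType d) (R : realType)
    (P : probability T R) (n : nat -> nat)
    (C : nat -> T -> nat * seq nat) (Pi : nat -> T -> two_line) : Prop :=
  MultisetCrp {
    crp_measurable_choice : forall t c, measurable [set w | C t w = c];
    crp_measurable_perm : forall t p, measurable [set w | Pi t w = p];
    crp_init : forall w, Pi 0 w = [::];
    crp_valid : forall t w, valid_choice n t.+1 (C t.+1 w);
    crp_next : forall t w, Pi t.+1 w = crp_step t.+1 (C t.+1 w) (Pi t w);
    crp_law : forall t (h : nat -> two_line) c, valid_choice n t.+1 c ->
      P [set w | (forall s, (s <= t)%N -> Pi s w = h s) /\ C t.+1 w = c] =
      (P [set w | forall s, (s <= t)%N -> Pi s w = h s] *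
       ('C(partial_sum n t.+1, n t.+1)%:R^-1)%:E)%E
  }.

(* The random variables X_i, i in I, are mutually independent. Every subset of
   nat is measurable, hence arbitrary sets B i. *)
Definition mutually_independent (d : measure_display) (T : measurableType d)
    (R : realType) (P : probability T R) (I : set nat) (X : nat -> T -> nat) :=
  forall (J : {fset nat}) (B : nat -> set nat), [set` J] `<=` I ->
    P [set w | forall i, i \in J -> B i (X i w)] =
    (\prod_(i <- J) P [set w | B i (X i w)])%E.

(* Binomial coefficient with a top entry >= -1: binom(-1, 0) = 1 and
   binom(-1, k) = 0 for k >= 1. *)
Definition binz (a : int) (k : nat) : nat :=
  if a is Posz m then 'C(m, k) else k == 0.

(* Meaningful for 1 <= r <= kappa <= N; the nat subtractions are then exact,
   except M - r + 1, which is therefore computed as (M + 1) - r. *)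
Definition neg_hypergeometric_pmf (R : realType) (N M r kappa : nat) : R :=
  ('C(M, r.-1)%:R * 'C(N - M, kappa - r)%:R / 'C(N, kappa.-1)%:R
   * ((M.+1 - r)%:R / (N - kappa).+1%:R))%R.

Definition neg_hypergeometric (d : measure_display) (T : measurableType d)
    (R : realType) (P : probability T R) (Y : T -> nat) (N M r : nat) :=
  forall kappa, P [set w | Y w = kappa] =
    (if (r <= kappa <= N)%N then neg_hypergeometric_pmf R N M r kappa else 0%R)%:E.

(* Main.v *)
(** In a canonical cycle (x_1 .. x_m y) the letter y occurs once, so the cycle is
    a walk that starts at y, follows the columns and stops on the first return to
    y. A family of canonical factors is thus a concatenation of such walks, and
    can be read back from its product, because stable sorting preserves the list
    of the columns with a given top entry. This gives uniqueness in Knuth's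
    theorem.

    Inserting copies of t in the factors and then erasing them gives the factors
    back, so the permutation at step t determines all the choices up to step t.
    The conditional law of a step given the history therefore multiplies up: the
    choices are independent, and the one at step t is uniform over its
    binom(N_t, n_t) values. Uniformity of the permutation follows, since every
    word in M(n_1, .., n_t) is the concatenation of the factors for some sequence
    of choices, which makes the injection from sequences of choices to
    permutations a bijection. The increment X_t is a function of the choice at
    step t, and its law is a count of weak compositions. *)

Require Import Defs.
From HB Require Import structures.
From mathcomp Require Import all_boot all_order all_algebra.
From mathcomp Require Import finmap.
From mathcomp Require Import all_classical all_reals all_analysis.
From mathcomp Require Import zify ring.

Import Order.TTheory GRing.Theory Num.Theory.

Local Open Scope classical_set_scope.
Local Open Scope nat_scope.

(** * Uniqueness of the cycle factorisation *)

(* Equivalently, the two arrays have the same stable sort. *)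
Definition same_columns (a b : two_line) :=
  forall x, [seq c <- a | c.1 == x] = [seq c <- b | c.1 == x].

Lemma same_columns_trans a b c :
  same_columns a b -> same_columns b c -> same_columns a c.
Proof. by move=> ab bc x; rewrite ab bc. Qed.

Lemma same_columns_sym a b : same_columns a b -> same_columns b a.
Proof. by move=> ab x; rewrite ab. Qed.

Lemma same_columns_cat a b a' b' : same_columns a a' -> same_columns b b' ->
  same_columns (a ++ b) (a' ++ b').
Proof. by move=> aa bb x; rewrite !filter_cat aa bb. Qed.

(** Stability makes filtering commute with sorting, and columns with one common top entry are
    already sorted. *)
Lemma same_columns_sort a : same_columns (sort_columns a) a.
Proof.
move=> x; rewrite filter_sort; first last.
- by move=> c d e; apply: leq_trans.
- by move=> c d; apply: leq_total.
apply: sorted_sort => [c d e|]; first exact: leq_trans.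
elim: a => //= c a; case: eqP => //= cx.
case: [seq _ <- a | _] (filter_all (fun c : nat * nat => c.1 == x) a) => //= d s.
by case/andP=> /eqP -> _ ->; rewrite cx leqnn.
Qed.

Lemma same_columns_perm a b : same_columns a b -> perm_eq a b.
Proof.
move=> ab; apply/allP => c _ /=; apply/eqP.
have count_top s : count_mem c s = count_mem c [seq d <- s | d.1 == c.1].
  by rewrite count_filter; apply: eq_count => d /=; case: eqP => // ->; rewrite eqxx.
by rewrite count_top ab -count_top.
Qed.

Lemma same_columns_cons x b b' (u v : two_line) :
  same_columns ((x, b) :: u) ((x, b') :: v) -> b = b' /\ same_columns u v.
Proof.
move=> uv; have := uv x; rewrite /= eqxx => -[bb _]; split=> // y.
by have := uv y; rewrite /= bb; case: eqP => // _ [].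
Qed.

Definition walk (x : nat) (s : seq nat) : two_line := pairmap pair x s.

Lemma unzip1_walk x s : unzip1 (walk x s) = belast x s.
Proof. by elim: s x => //= y s ih x; rewrite ih. Qed.

Lemma unzip2_walk x s : unzip2 (walk x s) = s.
Proof. by elim: s x => //= y s ih x; rewrite ih. Qed.

(** The unsorted counterpart of [cycles_product]: each cycle is cut open at its last letter y, so
    that its walk leaves from y and ends at y. *)
Definition walks (cs : seq (seq nat)) : two_line :=
  flatten [seq walk (last 0 c) c | c <- cs].

Lemma canonical_cycle_rcons s y :
  canonical_cycle (rcons s y) = all (fun x => y < x) s.
Proof.
rewrite /canonical_cycle last_rcons size_rcons /= -cats1 take_size_cat //.
by case: s.
Qed.

Lemma canonical_cycleP c : reflect
  (exists s y, c = rcons s y /\ all (fun x => y < x) s) (canonical_cycle c).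
Proof.
apply: (iffP idP) => [|[s [y [-> ?]]]]; last by rewrite canonical_cycle_rcons.
by case/lastP: c => // s y; rewrite canonical_cycle_rcons; exists s, y.
Qed.

Lemma zip_rcons_walk h s a :
  zip (h :: s) (rcons s a) = rcons (walk h s) (last h s, a).
Proof. by elim: s h => //= x s ih h; rewrite -ih. Qed.

(* The smallest entry y of a canonical cycle occurs once in it, so the column
   with top y may be moved to the front. *)
Lemma same_columns_cycle_perm c : canonical_cycle c ->
  same_columns (cycle_perm c) (walk (last 0 c) c).
Proof.
case/canonical_cycleP => s [y [-> ys]]; rewrite last_rcons.
apply: same_columns_trans (same_columns_sort _) _.
case: s ys => [|h s] ys //.
rewrite rcons_cons rot1_cons zip_rcons_walk last_rcons => x.
rewrite filter_rcons /=; case: eqP => // <-.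
rewrite (_ : [seq _ <- _ | _] = [::]) //; apply/eqP; rewrite -[_ == _]negbK -has_filter.
rewrite -(has_map fst (pred1 y)) [map _ _]unzip1_walk belast_rcons has_pred1.
by apply/negP => /(allP ys); rewrite ltnn.
Qed.

Lemma same_columns_cycles_product cs : all canonical_cycle cs ->
  same_columns (cycles_product cs) (walks cs).
Proof.
elim: cs => //= c cs ih /andP[cc /ih {}ih].
apply: same_columns_trans (same_columns_sort _) _.
by apply: same_columns_cat ih; apply: same_columns_cycle_perm.
Qed.

Lemma unzip2_walks cs : unzip2 (walks cs) = flatten cs.
Proof.
elim: cs => //= c cs ih.
by rewrite /unzip2 map_cat -/(unzip2 _) unzip2_walk -/(unzip2 _) ih.
Qed.

Lemma perm_unzip1_walks cs : all canonical_cycle cs ->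
  perm_eq (unzip1 (walks cs)) (flatten cs).
Proof.
elim: cs => //= c cs ih /andP[/canonical_cycleP[s [y [-> _]]] /ih {}ih].
rewrite /unzip1 map_cat -!/(unzip1 _) unzip1_walk last_rcons belast_rcons.
by apply: perm_cat ih; rewrite perm_sym perm_rcons.
Qed.

(* A canonical cycle can be read off the columns: start at its smallest entry y,
   follow the columns, and stop when y comes back. *)
Lemma same_columns_walk_cancel y s s' x (u v : two_line) :
  all (fun z => y < z) s -> all (fun z => y < z) s' ->
  same_columns (walk x (rcons s y) ++ u) (walk x (rcons s' y) ++ v) ->
  s = s' /\ same_columns u v.
Proof.
elim: s s' x => [|a s ih] [|a' s'] x /=.
- by move=> _ _ /same_columns_cons[].
- by move=> _ /andP[ya _] /same_columns_cons[ya' _]; rewrite -ya' ltnn in ya.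
- by move=> /andP[ya _] _ /same_columns_cons[ya' _]; rewrite ya' ltnn in ya.
move=> /andP[_ ys] /andP[_ ys'] /same_columns_cons[<-].
by move=> /(ih _ _ ys ys')[-> ?].
Qed.

(** The ends of the cycles increase weakly and each end is the least letter of its cycle, so the
    first end bounds all letters. *)
Lemma canonical_factors_min s y cs : canonical_factors (rcons s y :: cs) ->
  all (leq y) (flatten (rcons s y :: cs)).
Proof.
rewrite /canonical_factors /= canonical_cycle_rcons last_rcons.
case/andP=> /andP[ys ccs] /(order_path_min leq_trans) ycs.
rewrite all_cat all_rcons leqnn (sub_all _ ys) => [|x /ltnW] //=.
elim: cs ccs ycs => //= c cs ih /andP[/canonical_cycleP[s' [z [-> zs]]] ccs].
rewrite last_rcons => /andP[yz /(ih ccs) ycs].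
rewrite all_cat all_rcons yz ycs andbT /=.
by apply: sub_all zs => x /ltnW; apply: leq_trans.
Qed.

Lemma canonical_factors_behead c cs :
  canonical_factors (c :: cs) -> canonical_factors cs.
Proof.
by rewrite /canonical_factors /= => /andP[/andP[_ ->] /path_sorted].
Qed.

(** The bottom entries of the walks are the letters, so both families have the same least letter.
    Both first walks start there; they agree and cancel, and induction handles the rest. *)
Lemma canonical_factors_walks_inj cs cs' :
  canonical_factors cs -> canonical_factors cs' ->
  same_columns (walks cs) (walks cs') -> cs = cs'.
Proof.
elim: cs cs' => [|c cs ih] [|c' cs'] // can can' eqW;
  have /(perm_map snd) := same_columns_perm _ _ eqW;
  rewrite -!/(unzip2 _) !unzip2_walks.
- case/andP: can' => /andP[/canonical_cycleP[s [y [-> _]]] _] _.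
  by move/perm_size; rewrite /= size_cat size_rcons.
- case/andP: can => /andP[/canonical_cycleP[s [y [-> _]]] _] _.
  by move/perm_size; rewrite /= size_cat size_rcons.
have /andP[/andP[/canonical_cycleP[s [y [cE ys]]] _] _] := can.
have /andP[/andP[/canonical_cycleP[s' [y' [cE' ys']]] _] _] := can'.
subst c c' => eqf.
have yy' : y = y'.
  apply/eqP; rewrite eqn_leq.
  rewrite (allP (canonical_factors_min _ _ _ can)) ?(perm_mem eqf) /=; last first.
    by rewrite mem_cat mem_rcons mem_head.
  rewrite (allP (canonical_factors_min _ _ _ can')) -?(perm_mem eqf) //=.
  by rewrite mem_cat mem_rcons mem_head.
subst y'; rewrite /walks /= !last_rcons in eqW.
have [-> eqW'] := same_columns_walk_cancel _ _ _ _ _ _ ys ys' eqW.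
congr (_ :: _); apply: ih => //.
- exact: canonical_factors_behead can.
- exact: canonical_factors_behead can'.
Qed.

Lemma cycles_product_inj cs cs' :
  canonical_factors cs -> canonical_factors cs' ->
  cycles_product cs = cycles_product cs' -> cs = cs'.
Proof.
move=> can can' eqp; apply: canonical_factors_walks_inj => //.
have /andP[ccs _] := can; have /andP[ccs' _] := can'.
apply: same_columns_trans (same_columns_cycles_product _ ccs').
by rewrite -eqp; apply/same_columns_sym/same_columns_cycles_product.
Qed.

(** The set inside [xget] contains cs, so the selected family is canonical with the same product,
    hence equal to cs. *)
Lemma cycle_factorsK cs :
  canonical_factors cs -> cycle_factors (cycles_product cs) = cs.
Proof.
move=> can; rewrite /cycle_factors.
set A := [set _ | _]; have Acs : A cs by [].
have [can' eqp] : A (xget [::] A) by apply: xgetI Acs.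
exact: cycles_product_inj eqp.
Qed.

(** * Insertion of copies of a new largest letter *)

Lemma insert_in_cycle_cat t m1 m2 c1 c2 : size m1 = size c1 ->
  insert_in_cycle t (m1 ++ m2) (c1 ++ c2) =
  insert_in_cycle t m1 c1 ++ insert_in_cycle t m2 c2.
Proof. by move=> eqs; rewrite /insert_in_cycle zip_cat // map_cat flatten_cat. Qed.

Lemma insert_in_cycle_cons t a m x c : insert_in_cycle t (a :: m) (x :: c) =
  nseq a t ++ x :: insert_in_cycle t m c.
Proof. by rewrite /insert_in_cycle /= cat_rcons. Qed.

Lemma perm_insert_in_cycle t m c : size m = size c ->
  perm_eq (insert_in_cycle t m c) (c ++ nseq (sumn m) t).
Proof.
elim: c m => [|x c ih] [|a m] //= [/ih {}ih].
rewrite insert_in_cycle_cons perm_catC /= perm_cons.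
by rewrite addnC nseqD catA perm_cat2r.
Qed.

Lemma filter_insert_in_cycle t m c : t \notin c -> size m = size c ->
  [seq x <- insert_in_cycle t m c | x != t] = c.
Proof.
elim: c m => [|x c ih] [|a m] //=; rewrite inE negb_or => /andP[tx tc] [/(ih _ tc) {}ih].
by rewrite insert_in_cycle_cons filter_cat filter_nseq eqxx /= eq_sym tx ih.
Qed.

(** The letters of c differ from t, so each multiplicity is the length of the run of t before a
    letter, and k is the length of the final run. *)
Lemma insert_in_cycle_inj t c m m' k k' :
  t \notin c -> size m = size c -> size m' = size c ->
  insert_in_cycle t m c ++ nseq k t = insert_in_cycle t m' c ++ nseq k' t ->
  k = k' /\ m = m'.
Proof.
elim: c m m' => [|x c ih] [|a m] [|a' m'] //=.
  by move=> _ _ _ /(congr1 size); rewrite !size_nseq.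
rewrite inE negb_or => /andP[tx tc] [sm] [sm'].
rewrite !insert_in_cycle_cons -!catA.
elim: a a' => [|a iha] [|a'] /=.
- by case=> /(ih _ _ tc sm sm')[-> ->].
- by case=> xt; rewrite xt eqxx in tx.
- by case=> xt; rewrite xt eqxx in tx.
- by case=> /iha[-> [-> ->]].
Qed.

Lemma insert_in_cycle_surj t w : exists m k,
  size m = size [seq x <- w | x != t] /\
  w = insert_in_cycle t m [seq x <- w | x != t] ++ nseq k t.
Proof.
elim: w => [|x w [m [k [sm wE]]]] /=; first by exists [::], 0.
case: eqP => [->|_] /=; last first.
  by exists (0 :: m), k; rewrite /= sm; split=> //; rewrite {1}wE.
(* A leading t lengthens the run before the first other letter, or the final run if there is no
   other letter. *)
case: m sm wE => [|a m]; case: [seq _ <- w | _] => [|y s] // sm wE.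
- by exists [::], k.+1; split=> //; rewrite {1}wE.
- by exists (a.+1 :: m), k; split=> //; rewrite {1}wE.
Qed.

Definition insert_in_cycles t m (cs : seq (seq nat)) :=
  [seq insert_in_cycle t mc.1 mc.2 | mc <- zip (reshape (shape cs) m) cs].

Lemma insert_in_factorsE t c cs :
  insert_in_factors t c cs = insert_in_cycles t c.2 cs ++ nseq c.1 [:: t].
Proof. by []. Qed.

Lemma size_take_drop (m c s : seq nat) : size m = size (c ++ s) ->
  size (take (size c) m) = size c /\ size (drop (size c) m) = size s.
Proof.
rewrite size_cat => sm; rewrite size_takel ?size_drop ?sm ?addKn //.
exact: leq_addr.
Qed.

Lemma flatten_insert_in_cycles t m cs : size m = size (flatten cs) ->
  flatten (insert_in_cycles t m cs) = insert_in_cycle t m (flatten cs).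
Proof.
elim: cs m => [|c cs ih] m /=; first by case: m.
move=> /size_take_drop[s1 s2]; rewrite ih //.
by rewrite -{3}(cat_take_drop (size c) m) insert_in_cycle_cat.
Qed.

(** On the concatenated word the cycle boundaries disappear, so choices can be recovered from words
    and constructed for words. *)
Lemma flatten_insert_in_factors t c cs : size c.2 = size (flatten cs) ->
  flatten (insert_in_factors t c cs) =
  insert_in_cycle t c.2 (flatten cs) ++ nseq c.1 t.
Proof.
move=> sc; rewrite insert_in_factorsE flatten_cat flatten_insert_in_cycles //.
by congr (_ ++ _); elim: c.1 => //= k ->.
Qed.

Lemma size_insert_in_factors t c cs :
  size (insert_in_factors t c cs) = size cs + c.1.
Proof.
rewrite /insert_in_factors size_cat size_nseq size_map size_zip size_reshape.
by rewrite size_map minnn.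
Qed.

Lemma insert_in_cycle_rcons t m a c x : size m = size c ->
  insert_in_cycle t (rcons m a) (rcons c x) =
  rcons (insert_in_cycle t m c ++ nseq a t) x.
Proof.
move=> sm; rewrite -2!cats1 insert_in_cycle_cat // /insert_in_cycle /= cats0.
by rewrite rcons_cat.
Qed.

(** Copies of t go to the left of letters, so the end of the cycle stays last, and they exceed
    it. *)
Lemma canonical_insert_in_cycle t m c :
  canonical_cycle c -> all (fun x => x < t) c -> size m = size c ->
  canonical_cycle (insert_in_cycle t m c) /\
  last 0 (insert_in_cycle t m c) = last 0 c.
Proof.
case/canonical_cycleP => s [y [-> ys]]; rewrite all_rcons => /andP[yt st].
case/lastP: m => [|m a]; rewrite !size_rcons // => -[sm].
rewrite insert_in_cycle_rcons // !last_rcons canonical_cycle_rcons; split=> //.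
rewrite all_cat (perm_all _ (perm_insert_in_cycle _ _ _ sm)) all_cat ys.
by rewrite !all_nseq yt !orbT.
Qed.

Lemma canonical_insert_in_cycles t m cs :
  all canonical_cycle cs -> all (fun x => x < t) (flatten cs) ->
  size m = size (flatten cs) ->
  all canonical_cycle (insert_in_cycles t m cs) /\
  map (last 0) (insert_in_cycles t m cs) = map (last 0) cs.
Proof.
elim: cs m => [|c cs ih] m /=; first by case: m.
move=> /andP[cc ccs]; rewrite all_cat => /andP[ct cst] /size_take_drop[s1 s2].
have [-> ->] := canonical_insert_in_cycle _ _ _ cc ct s1.
by have [-> ->] := ih _ ccs cst s2.
Qed.

Lemma canonical_insert_in_factors t c cs :
  canonical_factors cs -> all (fun x => x < t) (flatten cs) ->
  size c.2 = size (flatten cs) ->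
  canonical_factors (insert_in_factors t c cs).
Proof.
move=> /andP[ccs sorted_cs] cst sc.
have [ccs' lastE] := canonical_insert_in_cycles _ _ _ ccs cst sc.
rewrite /canonical_factors insert_in_factorsE all_cat ccs' all_nseq orbT /=.
rewrite map_cat lastE map_nseq /= sorted_pairwise; last exact: leq_trans.
rewrite pairwise_cat -!sorted_pairwise ?sorted_cs; try exact: leq_trans.
(* The old ends are letters below t, and the ends of the new singletons all equal t. *)
apply/andP; split.
  apply/allrelP => x y /mapP[z zcs ->] /nseqP[-> _].
  have /canonical_cycleP[s [y' [zE _]]] := allP ccs _ zcs.
  rewrite zE last_rcons ltnW // (allP cst) //.
  by apply/flattenP; exists z => //; rewrite zE mem_rcons mem_head.
case: c.1 => //= k; elim: k => //= k ->.
by rewrite leqnn.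
Qed.

Lemma perm_insert_in_factors t c cs : size c.2 = size (flatten cs) ->
  perm_eq (flatten (insert_in_factors t c cs))
          (flatten cs ++ nseq (c.1 + sumn c.2) t).
Proof.
move=> sc; rewrite flatten_insert_in_factors // addnC nseqD catA perm_cat2r.
exact: perm_insert_in_cycle.
Qed.

(** Only the new singletons become empty when t is erased: an old cycle is nonempty and free of t,
    so it comes back intact. *)
Lemma erase_insert_in_factors t c cs :
  all canonical_cycle cs -> t \notin flatten cs -> size c.2 = size (flatten cs) ->
  [seq d <- [seq [seq x <- d | x != t] | d <- insert_in_factors t c cs] | d != [::]]
  = cs.
Proof.
rewrite insert_in_factorsE map_cat filter_cat map_nseq /= eqxx filter_nseq /= cats0.
elim: cs c.2 => [|c' cs ih] m /=; first by case: m.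
move=> /andP[cc' ccs]; rewrite mem_cat negb_or => /andP[tc' tcs] /size_take_drop[s1 s2].
rewrite filter_insert_in_cycle // ih //.
by case: c' cc' {tc' s1 s2}.
Qed.

Lemma insert_in_factors_inj t c c' cs cs' :
  all canonical_cycle cs -> all canonical_cycle cs' ->
  t \notin flatten cs -> t \notin flatten cs' ->
  size c.2 = size (flatten cs) -> size c'.2 = size (flatten cs') ->
  insert_in_factors t c cs = insert_in_factors t c' cs' -> c = c' /\ cs = cs'.
Proof.
move=> ccs ccs' tcs tcs' sc sc' eqi.
have eqcs : cs = cs'.
  by rewrite -(erase_insert_in_factors t c cs) // eqi erase_insert_in_factors.
subst cs'; split=> //.
have := congr1 flatten eqi; rewrite !flatten_insert_in_factors //.
by case: c c' {eqi} sc sc' => [k m] [k' m'] /= sc sc' /insert_in_cycle_inj[] // -> ->.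
Qed.

(** * Counting choices and multiset permutations *)

Lemma partial_sum0 n : partial_sum n 0 = 0.
Proof. by rewrite /partial_sum big_geq. Qed.

Lemma partial_sumS n t : partial_sum n t.+1 = partial_sum n t + n t.+1.
Proof. by rewrite /partial_sum big_nat_recr. Qed.

Lemma multisetS n t : multiset n t.+1 = multiset n t ++ nseq (n t.+1) t.+1.
Proof.
by rewrite /multiset -[X in iota 1 X]addn1 iotaD map_cat flatten_cat /= cats0 add1n.
Qed.

Lemma size_multiset n t : size (multiset n t) = partial_sum n t.
Proof.
elim: t => [|t ih]; first by rewrite partial_sum0.
by rewrite multisetS size_cat ih size_nseq partial_sumS.
Qed.

Lemma multiset_le n t : all (fun x => x < t.+1) (multiset n t).
Proof.
elim: t => // t ih; rewrite multisetS all_cat all_nseq ltnSn orbT andbT.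
by apply: sub_all ih => x /ltnW.
Qed.

Lemma sorted_multiset n t : sorted leq (multiset n t).
Proof.
elim: t => // t ih; rewrite multisetS sorted_pairwise; last exact: leq_trans.
rewrite pairwise_cat -!sorted_pairwise ?ih; try exact: leq_trans.
rewrite /=; apply/andP; split.
  apply/allrelP => x y /(allP (multiset_le n t)) xt /nseqP[-> _].
  exact: ltnW.
case: (n t.+1) => //= k; elim: k => //= k ->.
by rewrite leqnn.
Qed.

Fixpoint weak_compositions (l s : nat) : seq (seq nat) :=
  if l is k.+1 then
    [seq i :: m | i <- iota 0 s.+1, m <- weak_compositions k (s - i)]
  else if s == 0 then [:: [::]] else [::].

Lemma weak_compositionsS l s : weak_compositions l.+1 s =
  [seq i :: m | i <- iota 0 s.+1, m <- weak_compositions l (s - i)].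
Proof. by []. Qed.

Lemma mem_weak_compositions l s m :
  (m \in weak_compositions l s) = (size m == l) && (sumn m == s).
Proof.
elim: l s m => [|l ih] s m; first by case: m => [|a m]; case: s.
rewrite weak_compositionsS; apply/idP/idP.
  case/allpairsPdep => i [m' [+ + ->]]; rewrite mem_iota ih /= add0n ltnS.
  by move=> si /andP[/eqP -> /eqP ->]; rewrite eqxx subnKC //=.
case: m => // a m /andP[sm /eqP <-].
apply/allpairsPdep; exists a, m; split=> //; first by rewrite mem_iota /= add0n ltnS leq_addr.
by rewrite ih addKn eqxx andbT.
Qed.

Lemma uniq_weak_compositions l s : uniq (weak_compositions l s).
Proof.
elim: l s => [|l ih] s; first by rewrite /=; case: ifP.
rewrite weak_compositionsS; apply: allpairs_uniq_dep; first exact: iota_uniq.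
- by move=> i _; apply: ih.
- by move=> [i m] [i' m'] _ _ /= [-> ->].
Qed.

(** Stars and bars: splitting off the first part gives a hockey-stick sum of binomials. For l = 0
    and s = 0 the top entry is -1 and the convention gives 1. *)
Lemma size_weak_compositions l s :
  size (weak_compositions l s) = binz (l%:Z - 1 + s%:Z)%R s.
Proof.
have size_S k r : size (weak_compositions k.+1 r) =
    \sum_(j < r.+1) size (weak_compositions k j).
  rewrite weak_compositionsS size_allpairs_dep sumnE big_map.
  rewrite -[iota 0 r.+1]/(index_iota 0 r.+1) big_mkord.
  rewrite (reindex_inj rev_ord_inj) /=; apply: eq_bigr => j _.
  by rewrite subSS subKn // -ltnS.
case: l => [|l].
  by case: s => [|s] //; rewrite add0r addrC subzSS subr0 /= bin_small.
have -> : (l.+1%:Z - 1 + s%:Z)%R = Posz (l + s) by rewrite subzSS subr0.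
rewrite /binz; elim: l s => [|l ih] s.
  rewrite size_S (bigD1 ord0) //= big1 => [|[[|j] ?] //].
  by rewrite add0n binn.
rewrite size_S; under eq_bigr do rewrite ih.
elim: s => [|s ihs]; first by rewrite big_ord_recr big_ord0 /= !bin0.
by rewrite big_ord_recr /= ihs addSnnS addSn binS addnC.
Qed.

(** A choice (k, m) at step t + 1 is the weak composition k :: m of n_{t+1} into N_t + 1 parts. *)
Definition choices n t : seq (nat * seq nat) :=
  [seq (head 0 m, behead m) | m <- weak_compositions (partial_sum n t).+1 (n t.+1)].

Lemma mem_choices n t c : (c \in choices n t) = valid_choice n t.+1 c.
Proof.
case: c => k m; rewrite /valid_choice /=; apply/mapP/idP.
  case=> [[|k' m']]; rewrite mem_weak_compositions // => /andP[/= sm sumk] [-> ->].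
  by rewrite -eqSS sm.
move=> ?; exists (k :: m) => //.
by rewrite mem_weak_compositions /= eqSS.
Qed.

Lemma uniq_choices n t : uniq (choices n t).
Proof.
rewrite map_inj_in_uniq ?uniq_weak_compositions // => -[|a m] [|b m'] //;
  rewrite !mem_weak_compositions //= => _ _ [-> ->] //.
Qed.

Lemma size_choices n t : size (choices n t) = 'C(partial_sum n t.+1, n t.+1).
Proof.
rewrite size_map size_weak_compositions partial_sumS.
by rewrite subzSS subr0.
Qed.

Lemma size_choices_gt0 n t : 0 < size (choices n t).
Proof. by rewrite size_choices bin_gt0 partial_sumS leq_addl. Qed.

Lemma count_choices n t k : k <= n t.+1 ->
  count (fun c => c.1 == k) (choices n t) =
  size (weak_compositions (partial_sum n t) (n t.+1 - k)).
Proof.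
move=> kn; rewrite -size_filter -[RHS](size_map (fun m => (k, m))).
apply/perm_size/uniq_perm.
- exact/filter_uniq/uniq_choices.
- by rewrite map_inj_uniq ?uniq_weak_compositions // => m m' [].
move=> [k' m]; rewrite mem_filter mem_choices /valid_choice /=.
apply/andP/mapP.
  case=> /eqP -> /andP[sm /eqP kE]; exists m => //.
  by rewrite mem_weak_compositions sm -kE addKn eqxx.
case=> m'; rewrite mem_weak_compositions => /andP[sm /eqP sumE] [-> ->].
by rewrite eqxx sm sumE subnKC /=.
Qed.

(* The choice made at step t.+1 has index t. *)
Fixpoint crp_factors (c : nat -> nat * seq nat) (t : nat) : seq (seq nat) :=
  if t is u.+1 then insert_in_factors u.+1 (c u) (crp_factors c u) else [::].

Definition valid_choices n t (c : nat -> nat * seq nat) :=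
  forall u, u < t -> valid_choice n u.+1 (c u).

Lemma valid_choicesS n t c : valid_choices n t.+1 c ->
  valid_choice n t.+1 (c t) /\ valid_choices n t c.
Proof. by move=> vc; split=> [|u ut]; apply: vc => //; apply: ltnW. Qed.

(** Canonicity lets [cycle_factors] read the family back; the list of letters shows that t + 1 is
    new and largest at the next step. *)
Lemma crp_factors_invariant n t c : valid_choices n t c ->
  canonical_factors (crp_factors c t) /\
  perm_eq (flatten (crp_factors c t)) (multiset n t).
Proof.
elim: t => //= t ih /valid_choicesS[/andP[/eqP sc /eqP sumc] /ih[can fm]].
have sf : size (c t).2 = size (flatten (crp_factors c t)).
  by rewrite sc (perm_size fm) size_multiset.
split.
  apply: canonical_insert_in_factors => //.
  by rewrite (perm_all _ fm) multiset_le.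
rewrite (permPl (perm_insert_in_factors _ _ _ sf)) sumc multisetS.
by rewrite perm_cat2r.
Qed.

Lemma size_crp_choice n t c : valid_choices n t.+1 c ->
  size (c t).2 = size (flatten (crp_factors c t)).
Proof.
case/valid_choicesS => /andP[/eqP -> _] /crp_factors_invariant[_ /perm_size ->].
by rewrite size_multiset.
Qed.

Lemma notin_crp_factors n t c : valid_choices n t c ->
  t.+1 \notin flatten (crp_factors c t).
Proof.
case/crp_factors_invariant => _ /perm_mem ->.
by apply/negP => /(allP (multiset_le n t)); rewrite ltnn.
Qed.

Lemma crp_factors_inj n t c c' : valid_choices n t c -> valid_choices n t c' ->
  crp_factors c t = crp_factors c' t -> forall u, u < t -> c u = c' u.
Proof.
elim: t => // t ih vc vc' /= eqf.
have [_ wc] := valid_choicesS _ _ _ vc; have [_ wc'] := valid_choicesS _ _ _ vc'.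
have [/andP[can _] _] := crp_factors_invariant _ _ _ wc.
have [/andP[can' _] _] := crp_factors_invariant _ _ _ wc'.
have [ct /(ih wc wc') cu] := insert_in_factors_inj _ _ _ _ _ can can'
  (notin_crp_factors _ _ _ wc) (notin_crp_factors _ _ _ wc')
  (size_crp_choice _ _ _ vc) (size_crp_choice _ _ _ vc') eqf.
by move=> u; rewrite ltnS leq_eqVlt => /predU1P[-> //|/cu].
Qed.

Lemma eq_crp_factors t c c' :
  (forall u, u < t -> c u = c' u) -> crp_factors c t = crp_factors c' t.
Proof.
elim: t => //= t ih cc; rewrite cc // ih // => u ut.
exact/cc/ltnW.
Qed.

(** Erase the largest letter from w, build the remaining word by induction, and let the runs of the
    erased letter be the last choice. *)
Lemma crp_factors_surj n t w : perm_eq w (multiset n t) ->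
  exists2 c, valid_choices n t c & flatten (crp_factors c t) = w.
Proof.
elim: t w => [|t ih] w pw.
  by exists (fun=> (0, [::])) => //; apply/esym/nilP; rewrite /nilp (perm_size pw).
have pf : perm_eq [seq x <- w | x != t.+1] (multiset n t).
  rewrite (permPl (perm_filter _ pw)) multisetS filter_cat filter_nseq eqxx cats0.
  rewrite (_ : [seq _ <- _ | _] = multiset n t) //; apply/all_filterP.
  by apply: sub_all (multiset_le n t) => x; rewrite ltn_neqAle => /andP[].
have [c vc cE] := ih _ pf.
have [m [k [sm wE]]] := insert_in_cycle_surj t.+1 w.
pose c' u := if u == t then (k, m) else c u.
have cc' : crp_factors c' t = crp_factors c t.
  by apply: eq_crp_factors => u ut; rewrite /c' ltn_eqF.
exists c'; last by rewrite /= cc' /c' eqxx flatten_insert_in_factors cE.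
move=> u; rewrite ltnS leq_eqVlt /c' => /predU1P[->|ut]; last first.
  by rewrite ltn_eqF //; apply: vc.
rewrite eqxx /valid_choice /= sm (perm_size pf) size_multiset eqxx /=.
have := perm_size pw; rewrite {1}wE size_cat size_nseq.
rewrite (perm_size (perm_insert_in_cycle _ _ _ sm)) size_cat size_nseq (perm_size pf).
by rewrite multisetS size_cat size_nseq -addnA => /addnI; rewrite addnC => ->.
Qed.

Fixpoint all_crp_factors n t : seq (seq (seq nat)) :=
  if t is u.+1 then
    [seq insert_in_factors u.+1 c cs | c <- choices n u, cs <- all_crp_factors n u]
  else [:: [::]].

Lemma all_crp_factorsP n t cs : reflect
  (exists2 c, valid_choices n t c & crp_factors c t = cs)
  (cs \in all_crp_factors n t).
Proof.
elim: t cs => [|t ih] cs /=.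
  by rewrite inE; apply: (iffP eqP) => [->|[c _ //]]; exists (fun=> (0, [::])).
apply: (iffP allpairsP) => [[[d cs'] /= [dn /ih[c vc <-] ->]]|[c vc <-]].
  pose c' u := if u == t then d else c u.
  exists c' => [u|].
    rewrite ltnS leq_eqVlt /c' => /predU1P[->|ut]; first by rewrite eqxx -mem_choices.
    by rewrite ltn_eqF //; apply: vc.
  rewrite {1}/c' eqxx; congr insert_in_factors; apply: eq_crp_factors => u ut.
  by rewrite /c' ltn_eqF.
have [vt vc'] := valid_choicesS _ _ _ vc.
by exists (c t, crp_factors c t); rewrite mem_choices vt; split=> //; apply/ih; exists c.
Qed.

Lemma size_all_crp_factors n t :
  size (all_crp_factors n t) = \prod_(u < t) size (choices n u).
Proof.
elim: t => [|t ih]; first by rewrite big_ord0.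
by rewrite big_ord_recr /= size_allpairs ih mulnC.
Qed.

Lemma uniq_all_crp_factors n t : uniq (all_crp_factors n t).
Proof.
elim: t => //= t ih; apply: allpairs_uniq => //; first exact: uniq_choices.
move=> [d cs] [d' cs'].
move=> /allpairsP[[d1 cs1] /= [dn /all_crp_factorsP[c vc cE] [-> ->]]].
move=> /allpairsP[[d2 cs2] /= [dn' /all_crp_factorsP[c' vc' cE'] [-> ->]]].
move: dn dn'; rewrite !mem_choices => /andP[/eqP sd _] /andP[/eqP sd' _].
subst cs1 cs2.
have [/andP[can _] pf] := crp_factors_invariant _ _ _ vc.
have [/andP[can' _] pf'] := crp_factors_invariant _ _ _ vc'.
case/insert_in_factors_inj => //; rewrite ?(notin_crp_factors _ _ _ vc) //.
- by rewrite (notin_crp_factors _ _ _ vc').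
- by rewrite sd (perm_size pf) size_multiset.
- by rewrite sd' (perm_size pf') size_multiset.
- by move=> -> ->.
Qed.

Lemma sorted_cycles_product cs : sorted leq (unzip1 (cycles_product cs)).
Proof.
case: cs => // c cs; rewrite /unzip1 sorted_map.
by apply: sort_sorted => x y; apply: leq_total.
Qed.

(** The top line is sorted and rearranges the multiset, hence is the multiset in order; the bottom
    line rearranges the same letters. *)
Lemma cycles_product_multiset_perms n t c : valid_choices n t c ->
  cycles_product (crp_factors c t) \in multiset_perms n t.
Proof.
case/crp_factors_invariant => /andP[can _] pf.
have pp := same_columns_perm _ _ (same_columns_cycles_product _ can).
rewrite -[cycles_product _]zip_unzip.
have -> : unzip1 (cycles_product (crp_factors c t)) = multiset n t.
  apply: (sorted_eq leq_trans anti_leq); first exact: sorted_cycles_product.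
    exact: sorted_multiset.
  rewrite -(permPr pf) -(permPr (perm_unzip1_walks _ can)).
  exact: perm_map.
apply: map_f; rewrite mem_permutations -(permPr pf) -unzip2_walks.
exact: perm_map.
Qed.

Lemma multiset_perms_crp n t :
  size (multiset_perms n t) = \prod_(u < t) size (choices n u) /\
  forall p, p \in multiset_perms n t ->
    exists2 c, valid_choices n t c & cycles_product (crp_factors c t) = p.
Proof.
set L := [seq cycles_product cs | cs <- all_crp_factors n t].
have uL : uniq L.
  rewrite map_inj_in_uniq ?uniq_all_crp_factors // => cs cs'.
  move=> /all_crp_factorsP[c /crp_factors_invariant[can _] <-].
  move=> /all_crp_factorsP[c' /crp_factors_invariant[can' _] <-].
  exact: cycles_product_inj.
have subL : {subset L <= multiset_perms n t}.
  move=> p /mapP[cs /all_crp_factorsP[c vc <-] ->].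
  exact: cycles_product_multiset_perms.
(* The word [flatten cs] is in general not the bottom line of the product of cs. Only cardinalities
   are compared: concatenation maps the families onto all words, so there are at least as many
   families as permutations. *)
have leL : size (multiset_perms n t) <= size L.
  rewrite !size_map -(size_map flatten (all_crp_factors n t)).
  apply: uniq_leq_size => [|w]; first exact: permutations_uniq.
  rewrite mem_permutations => /crp_factors_surj[c vc <-].
  by apply: map_f; apply/all_crp_factorsP; exists c.
have [sL memL] := uniq_min_size uL subL leL.
split=> [|p]; first by rewrite -sL size_map size_all_crp_factors.
by rewrite -memL => /mapP[cs /all_crp_factorsP[c vc <-] ->]; exists c.
Qed.

(** * Law of the choices *)

Lemma probability_partition (d : measure_display) (T : measurableType d)
    (R : realType) (P : probability T R) (I : eqType) (Z : T -> I) (s : seq I)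
    (E : set T) :
  uniq s -> measurable E -> (forall z, measurable [set w | Z w = z]) ->
  (forall w, E w -> Z w \in s) ->
  P E = (\sum_(z <- s) P (E `&` [set w | Z w = z]))%E.
Proof.
move=> us mE mZ Es.
have -> : E = E `&` [set w | Z w \in s].
  by apply/seteqP; split=> [w Ew|w []//]; split=> //; apply: Es.
have {Es} -> : (\sum_(z <- s) P ((E `&` [set w | Z w \in s]) `&` [set w | Z w = z]) =
    \sum_(z <- s) P (E `&` [set w | Z w = z]))%E.
  rewrite !big_seq; apply: eq_bigr => z zs; congr (P _).
  by apply/seteqP; split=> [w [[]]//|w [Ew zE]]; split=> //; split=> //=; rewrite zE.
(* Measurability is carried through the induction because additivity asks for it. *)
suff [] : measurable (E `&` [set w | Z w \in s]) /\
    P (E `&` [set w | Z w \in s]) = (\sum_(z <- s) P (E `&` [set w | Z w = z]))%E by [].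
elim: s us => [_|z s ih /= /andP[zs /ih{ih} [ms Ps]]].
  have -> : E `&` [set w | Z w \in [::]] = set0 by apply/seteqP; split=> [w []|].
  by rewrite big_nil measure0; split=> //; apply: measurable0.
have -> : E `&` [set w | Z w \in z :: s] =
    (E `&` [set w | Z w = z]) `|` (E `&` [set w | Z w \in s]).
  apply/seteqP; split=> w /=.
    by rewrite inE => -[Ew /predU1P[|]]; [left|right].
  by rewrite inE => -[[Ew ->]|[Ew ->]]; rewrite ?eqxx ?orbT.
have mz : measurable (E `&` [set w | Z w = z]) by apply: measurableI.
rewrite big_cons -Ps; split; first exact: measurableU.
rewrite measureU //; apply/seteqP; split=> // w [[_ /= ->] [_ /=]].
by rewrite (negbTE zs).
Qed.

(** [cycle_factors] undoes the product taken at the previous step, so the process can be run on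
    families of factors. *)
Lemma crp_perm_factors (d : measure_display) (T : measurableType d)
    (R : realType) (P : probability T R) n C Pi t w :
  multiset_crp P n C Pi ->
  Pi t w = cycles_product (crp_factors (fun u => C u.+1 w) t).
Proof.
move=> crp; have vC u : valid_choice n u.+1 (C u.+1 w) by apply: (crp_valid crp).
elim: t => [|t ih]; first by rewrite (crp_init crp).
rewrite (crp_next crp) ih /crp_step cycle_factorsK //.
by apply: (proj1 (crp_factors_invariant n _ _ _)).
Qed.

Lemma crp_perm_choices (d : measure_display) (T : measurableType d)
    (R : realType) (P : probability T R) n C Pi t w c :
  multiset_crp P n C Pi -> valid_choices n t c ->
  Pi t w = cycles_product (crp_factors c t) <->
  (forall u, u < t -> C u.+1 w = c u).
Proof.
move=> crp vc; rewrite (crp_perm_factors _ _ _ _ _ _ _ _ _ crp).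
have vC : valid_choices n t (fun u => C u.+1 w).
  by move=> u _; apply: (crp_valid crp).
have [can _] := crp_factors_invariant _ _ _ vC.
have [can' _] := crp_factors_invariant _ _ _ vc.
split=> [/(cycles_product_inj _ _ can can')|/eq_crp_factors -> //].
exact: crp_factors_inj vC vc.
Qed.

(* The permutation at step t determines the choices up to step t, so that the
   conditional law given the history multiplies up. *)
Lemma crp_joint_law (d : measure_display) (T : measurableType d)
    (R : realType) (P : probability T R) n C Pi t c :
  multiset_crp P n C Pi -> valid_choices n t c ->
  P [set w | forall u, u < t -> C u.+1 w = c u] =
  (\prod_(u < t) (size (choices n u))%:R^-1)%R%:E.
Proof.
move=> crp; elim: t => [|t ih] vc.
  by rewrite big_ord0 (_ : [set _ | _] = setT) ?probability_setT //; apply/seteqP; split.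
have [vt wc] := valid_choicesS _ _ _ vc.
(* The history generated by c: following it up to step t amounts to making the first t choices of
   c. *)
pose h s := cycles_product (crp_factors c s).
have hP w : (forall s, s <= t -> Pi s w = h s) <-> (forall u, u < t -> C u.+1 w = c u).
  split=> [/(_ _ (leqnn t))|Cc s st].
    by apply: (proj1 (crp_perm_choices _ _ _ _ _ _ _ _ _ _ crp wc)).
  apply/(crp_perm_choices _ _ _ _ _ _ _ _ _ _ crp) => [u us|u us].
    by apply: wc; apply: leq_trans st.
  by apply: Cc; apply: leq_trans st.
have := crp_law crp h vt.
rewrite (_ : [set w | _ /\ _] = [set w | forall u, u < t.+1 -> C u.+1 w = c u]); last first.
  apply/seteqP; split=> w /=.
    case=> /hP Cc Ct u; rewrite ltnS leq_eqVlt => /predU1P[-> //|]; exact: Cc.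
  by move=> Cc; split; [apply/hP => u ut; apply/Cc/ltnW|apply: Cc].
rewrite (_ : [set w | forall s, s <= t -> _] = [set w | forall u, u < t -> C u.+1 w = c u]).
  by move=> ->; rewrite ih // big_ord_recr /= size_choices EFinM.
by apply/seteqP; split=> w /= /hP.
Qed.

Lemma measurable_crp_choices (d : measure_display) (T : measurableType d)
    (R : realType) (P : probability T R) n C Pi t
    (A : nat -> pred (nat * seq nat)) :
  multiset_crp P n C Pi -> measurable [set w | forall u, u < t -> A u (C u.+1 w)].
Proof.
move=> crp; elim: t => [|t ih].
  by rewrite (_ : [set _ | _] = setT) //; apply/seteqP; split.
rewrite (_ : [set _ | _] = [set w | forall u, u < t -> A u (C u.+1 w)] `&`
   \big[setU/set0]_(c <- choices n t | A t c) [set w | C t.+1 w = c]).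
  apply: measurableI => //; apply: bigsetU_measurable => c _.
  exact: (crp_measurable_choice crp).
rewrite -bigcup_seq_cond; apply/seteqP; split=> w /=.
  move=> Aw; split=> [u ut|]; first exact/Aw/ltnW.
  exists (C t.+1 w) => //=; rewrite mem_choices Aw // andbT.
  exact: (crp_valid crp).
move=> [Aw [c /= /andP[_ Ac] cE]] u; rewrite ltnS leq_eqVlt => /predU1P[->|/Aw //].
by rewrite cE.
Qed.

(** Independence and uniformity of the choices, expressed together on product events. *)
Lemma crp_choices_law (d : measure_display) (T : measurableType d)
    (R : realType) (P : probability T R) n C Pi t
    (A : nat -> pred (nat * seq nat)) :
  multiset_crp P n C Pi ->
  P [set w | forall u, u < t -> A u (C u.+1 w)] =
  (\prod_(u < t) ((count (A u) (choices n u))%:R / (size (choices n u))%:R))%R%:E.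
Proof.
move=> crp.
(* The constraints are released one after the other, from single choices to
   arbitrary events. *)
suff gen r : r <= t -> forall (B : nat -> pred (nat * seq nat)) c, valid_choices n t c ->
    (forall u, r <= u < t -> B u =1 pred1 (c u)) ->
    P [set w | forall u, u < t -> B u (C u.+1 w)] =
    (\prod_(u < t) ((count (B u) (choices n u))%:R / (size (choices n u))%:R))%R%:E.
  (* For r = t no event is tied to c, so any valid choices serve as c. *)
  apply: (gen t (leqnn t) A (fun u => head (0, [::]) (choices n u))) => [u _|u].
    rewrite -mem_choices; have := size_choices_gt0 n u.
    by case: (choices n u) => //= c s _; rewrite mem_head.
  by case/andP=> tu /(leq_ltn_trans tu); rewrite ltnn.
elim: r => [|r ih] rt B c vc Bc.
  rewrite (_ : [set _ | _] = [set w | forall u, u < t -> C u.+1 w = c u]); last first.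
    by apply/seteqP; split=> w /= h u ut; have := h u ut; rewrite Bc // => /eqP.
  rewrite (crp_joint_law _ _ _ _ _ _ _ _ _ crp vc); congr EFin.
  apply: eq_bigr => u _; have Bu : B u =1 pred1 (c u) by apply: Bc => /=.
  by rewrite (eq_count Bu) count_uniq_mem ?uniq_choices // mem_choices vc // mul1r.
(* Event r is released by splitting over the value z of its choice; each piece falls under the
   induction hypothesis, with event r shrunk to z. *)
rewrite (probability_partition _ _ _ P _ (C r.+1) (choices n r)); first last.
- by move=> w _; rewrite mem_choices; apply: (crp_valid crp).
- exact: (crp_measurable_choice crp).
- exact: (measurable_crp_choices _ _ _ _ _ _ _ _ _ crp).
- exact: uniq_choices.
set q := (\prod_(u < t | u != Ordinal rt)
  ((count (B u) (choices n u))%:R / (size (choices n u))%:R))%R : R.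
transitivity (\sum_(z <- choices n r | B r z) ((size (choices n r))%:R^-1 * q)%:E)%E.
  rewrite [RHS]big_mkcond /=; apply: eq_big_seq => z zn.
  case: ifP => Bz; last first.
    rewrite (_ : _ `&` _ = set0) ?measure0 //; apply/seteqP; split=> // w [/= Bw zE].
    by have := Bw r rt; rewrite zE Bz.
  pose B' u : pred (nat * seq nat) := if u == r then xpred1 z else B u.
  pose c' u : nat * seq nat := if u == r then z else c u.
  rewrite (_ : _ `&` _ = [set w | forall u, u < t -> B' u (C u.+1 w)]); last first.
    apply/seteqP; split=> w /=.
      by move=> [Bw zE] u ut; rewrite /B'; case: eqP => [->|_] /=; [apply/eqP|apply: Bw].
    move=> Bw; have := Bw r rt; rewrite {1}/B' eqxx => /eqP zE; split=> // u ut.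
    by have := Bw u ut; rewrite /B'; case: eqP => // -> _; rewrite zE.
  rewrite (ih (ltnW rt) _ c'); first last.
  - move=> u /andP[ru ut]; rewrite /B' /c'; case: eqP => // ur.
    by apply: Bc; rewrite ut andbT ltn_neqAle ru andbT eq_sym; apply/eqP.
  - by move=> u ut; rewrite /c'; case: eqP => [->|_]; [rewrite -mem_choices|apply: vc].
  congr EFin; rewrite (bigD1 (Ordinal rt)) //= {1}/B' eqxx.
  rewrite count_uniq_mem ?uniq_choices // zn mul1r; congr (_ * _)%R.
  apply: eq_bigr => u ur; rewrite /B' ifF //.
  by apply: contraNF ur => /eqP ur; apply/eqP/val_inj.
rewrite sumEFin big_const_seq iter_addr_0 (bigD1 (Ordinal rt)) //= -/q.
by rewrite -mulrA mulr_natl.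
Qed.

(** * Law of the number of new cycles *)

(** The marginal law is obtained by making all the other events certain. *)
Lemma crp_choice_law (d : measure_display) (T : measurableType d)
    (R : realType) (P : probability T R) n C Pi t (B : pred (nat * seq nat)) :
  multiset_crp P n C Pi ->
  P [set w | B (C t.+1 w)] =
  ((count B (choices n t))%:R / (size (choices n t))%:R)%R%:E.
Proof.
move=> crp; pose A u : pred (nat * seq nat) := if u == t then B else xpredT.
rewrite (_ : [set _ | _] = [set w | forall u, u < t.+1 -> A u (C u.+1 w)]); last first.
  apply/seteqP; split=> w /= => [Bw u _|/(_ _ (ltnSn t))]; rewrite /A; last by rewrite eqxx.
  by case: eqP => // ->.
rewrite (crp_choices_law _ _ _ _ _ _ _ _ _ crp) big_ord_recr /= {2}/A eqxx.
rewrite big1 ?mul1r // => u _; rewrite /A ltn_eqF // count_predT divff //.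
by rewrite pnatr_eq0 -lt0n size_choices_gt0.
Qed.

Lemma crp_new_cycles_independent (d : measure_display) (T : measurableType d)
    (R : realType) (P : probability T R) n C Pi :
  multiset_crp P n C Pi ->
  mutually_independent P [set t | 1 <= t] (fun t w => (C t w).1).
Proof.
move=> crp J B J1.
have [t Jt] : exists t, forall i, i \in J -> i < t.+1.
  by exists (\max_(i <- J) i) => i iJ; rewrite ltnS; apply: leq_bigmax_seq.
have BE i w : i \in J -> B i (C i w).1 <-> `[< B i.-1.+1 (C i.-1.+1 w).1 >].
  by move=> /J1 i1; rewrite (prednK i1); split=> /asboolP.
pose g u : R := ((count (fun c => `[< B u.+1 c.1 >]) (choices n u))%:R
                 / (size (choices n u))%:R)%R.
have PB i : i \in J -> P [set w | B i (C i w).1] = (g i.-1)%:E.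
  move=> iJ.
  rewrite -(crp_choice_law _ _ _ _ _ _ _ _ (fun c => `[< B i.-1.+1 c.1 >]) crp).
  by congr (P _); apply/seteqP; split=> w /= /BE; apply.
rewrite (eq_big_seq _ PB) -(big_morph EFin (@EFinM R) (erefl _)).
(* Steps outside J are left unconstrained and contribute factors 1. Step i has index i - 1 here,
   hence the reindexing at the end. *)
pose A u : pred (nat * seq nat) := fun c => (u.+1 \in J) ==> `[< B u.+1 c.1 >].
rewrite (_ : [set _ | _] = [set w | forall u, u < t -> A u (C u.+1 w)]); last first.
  apply/seteqP; split=> w /= Bw => [u ut|i iJ].
    by apply/implyP => uJ; apply/asboolP/Bw.
  apply/BE => //; have i1 : 0 < i by apply: J1.
  have := Bw i.-1; rewrite /A (prednK i1) iJ /=; apply.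
  exact: Jt.
rewrite (crp_choices_law _ _ _ _ _ _ _ _ _ crp); congr EFin.
transitivity (\prod_(u < t | u.+1 \in J) g u)%R.
  rewrite [RHS]big_mkcond /=; apply: eq_bigr => u _; rewrite /A /g.
  case: ifP => uJ //=; rewrite count_predT divff //.
  by rewrite pnatr_eq0 -lt0n size_choices_gt0.
rewrite -(big_mkord (fun u => u.+1 \in J) g) -big_filter.
rewrite -(big_map succn xpredT (fun i => g i.-1)).
apply/perm_big/uniq_perm.
- by rewrite map_inj_uniq ?filter_uniq ?iota_uniq //; apply: succn_inj.
- exact: fset_uniq.
move=> i; apply/mapP/idP => [[u]|iJ]; first by rewrite mem_filter => /andP[uJ _] ->.
have i1 : 0 < i by apply: J1.
exists i.-1; rewrite ?(prednK i1) // mem_filter (prednK i1) iJ mem_index_iota /=.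
by rewrite -ltnS (prednK i1) Jt.
Qed.

(** The closed form with denominators cleared, for N_{t-1} = m + 1 and n_t = j + k. Multiplied by k!
    j! m!, both sides become (m + 1 + j + k)!. *)
Lemma mul_bin_weak_compositions (m j k : nat) :
  'C(m + j, j) * ('C(m.+1 + j + k, k) * (m.+1 + j)) =
  'C(j + k, k) * m.+1 * 'C(m.+1 + j + k, j + k).
Proof.
have f_gt0 : 0 < k`! * j`! * m`! by rewrite !muln_gt0 !fact_gt0.
have e1 := bin_fact (leq_addl m j); have e2 := bin_fact (leq_addl (m.+1 + j) k).
have e3 := bin_fact (leq_addl j k).
have le4 : j + k <= m.+1 + j + k by rewrite -addnA leq_addl.
have e4 := bin_fact le4.
rewrite !addnK in e1 e2 e3; rewrite -[in X in _ * (_ * X)]addnA addnK in e4.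
apply/eqP; rewrite -(eqn_pmul2l f_gt0); apply/eqP.
transitivity ((m.+1 + j + k)`!).
  rewrite -e2 (_ : (m.+1 + j)`! = (m.+1 + j) * (m + j)`!) // -e1.
  by rewrite -!mulnA; nia.
rewrite -e4 -e3 factS; nia.
Qed.

Lemma count_new_cycles_closed_form (R : realType) (M m k : nat) :
  k <= m -> k < M + m ->
  ('C(M + m, m)%:R^-1 * (binz (M%:Z - 1 + (m - k)%:Z) (m - k))%:R)%R =
  ('C(m, k)%:R / 'C(M + m, k)%:R * (M%:R / (M + m - k)%:R))%R :> R.
Proof.
move=> km kMm; set j := m - k; have mE : m = j + k by rewrite subnK.
have nz a b : b <= a -> ('C(a, b)%:R != 0 :> R)%R by rewrite pnatr_eq0 -lt0n bin_gt0.
have nz2 : ((M + m - k)%:R != 0 :> R)%R by rewrite pnatr_eq0 -lt0n subn_gt0.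
have nz1 := nz _ _ (leq_addl M m).
have nz3 := nz _ _ (ltnW kMm).
case: M kMm nz1 nz2 nz3 => [|M] kMm nz1 nz2 nz3.
  (* For M = 0, as at the first step of the process, k < m makes j positive: the left side contains
     binom(j - 1, j) = 0 and the right side the factor M. *)
  have : 0 < j by rewrite subn_gt0.
  case: j {mE} => // j _; rewrite (_ : (_ + _)%R = Posz j); last first.
    by rewrite add0r addrC subzSS subr0.
  by rewrite /binz (bin_small (ltnSn j)) mul0r !mulr0.
rewrite (_ : (_ - 1 + _)%R = Posz (M + j)); last by rewrite subzSS subr0.
have := mul_bin_weak_compositions M j k; rewrite -addnA -mE /binz.
have -> : M.+1 + j = M.+1 + m - k by rewrite -addnBA.
move=> /(congr1 (fun x => x%:R : R)%R); rewrite !natrM => eqR.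
apply: (mulfI nz1); apply: (mulIf (mulf_neq0 nz3 nz2)).
rewrite mulVKf // {}eqR; field.
by rewrite nz2.
Qed.

Lemma crp_new_cycles_law (d : measure_display) (T : measurableType d)
    (R : realType) (P : probability T R) n C Pi t k :
  multiset_crp P n C Pi -> k <= n t.+1 ->
  P [set w | (C t.+1 w).1 = k] =
  ('C(partial_sum n t.+1, n t.+1)%:R^-1
   * (binz ((partial_sum n t)%:Z - 1 + (n t.+1 - k)%:Z) (n t.+1 - k))%:R)%R%:E.
Proof.
move=> crp kn; rewrite -size_weak_compositions -count_choices // -size_choices mulrC.
rewrite -(crp_choice_law _ _ _ _ _ _ _ _ _ crp).
by congr (P _); apply/seteqP; split=> w /eqP.
Qed.

(** The range goes beyond n_{t+1}, where both sides vanish, so as to cover the whole support of the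
    negative hypergeometric mass function. *)
Lemma crp_new_cycles_closed_form (d : measure_display) (T : measurableType d)
    (R : realType) (P : probability T R) n C Pi t k :
  multiset_crp P n C Pi -> k < partial_sum n t.+1 ->
  P [set w | (C t.+1 w).1 = k] =
  ('C(n t.+1, k)%:R / 'C(partial_sum n t.+1, k)%:R
   * ((partial_sum n t)%:R / (partial_sum n t.+1 - k)%:R))%R%:E.
Proof.
move=> crp kN; have [kn|nk] := leqP k (n t.+1).
  rewrite (crp_new_cycles_law _ _ _ _ _ _ _ _ _ crp kn); congr EFin.
  by rewrite partial_sumS in kN *; apply: count_new_cycles_closed_form.
rewrite bin_small // !mul0r (_ : [set _ | _] = set0) ?measure0 //.
apply/seteqP; split=> // w /= kE.
have /andP[_ /eqP sumc] := crp_valid crp t w.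
by move: nk; rewrite -kE -sumc ltnNge leq_addr.
Qed.

Lemma crp_neg_hypergeometric_pmf (d : measure_display) (T : measurableType d)
    (R : realType) (P : probability T R) n C Pi t kappa :
  multiset_crp P n C Pi -> 1 <= kappa <= partial_sum n t.+1 ->
  P [set w | (C t.+1 w).1.+1 = kappa] =
  (neg_hypergeometric_pmf R (partial_sum n t.+1) (partial_sum n t) 1 kappa)%:E.
Proof.
case: kappa => // k crp /= kN.
rewrite (_ : [set _ | _] = [set w | (C t.+1 w).1 = k]); last first.
  by apply/seteqP; split=> w /= => [[]|->].
rewrite (crp_new_cycles_closed_form _ _ _ _ _ _ _ _ _ crp kN); congr EFin.
(* With r = 1 and kappa = k + 1, binom(M, 0) is 1 and N - kappa + 1 is N - k. *)
rewrite /neg_hypergeometric_pmf /= bin0 mul1r !subn1 /= -subSn // subSS.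
by rewrite [X in X - partial_sum n t]partial_sumS addKn.
Qed.

Theorem mainTheorem4 (n : nat -> nat) (n_ge1 : forall s, 1 <= s -> 1 <= n s)
    (d : measure_display) (T : measurableType d) (R : realType)
    (P : probability T R)
    (C : nat -> T -> nat * seq nat) (Pi : nat -> T -> two_line)
    (crp : multiset_crp P n C Pi) :
  let N := partial_sum n in
  let X (t : nat) (w : T) : nat := (C t w).1 in
  let K (t : nat) (w : T) : nat := num_cycles (Pi t w) in
  [/\ (* uniformity at every step *)
      forall t p, p \in multiset_perms n t ->
        P [set w | Pi t w = p] = ((size (multiset_perms n t))%:R^-1)%:E,
      (* number of cycles as the sum of the increments *)
      forall t w, K t w = \sum_(1 <= s < t.+1) X s w,
      mutually_independent P [set t | 1 <= t] X,
      (* law of the increments; the closed form is 0 / 0 when k = N t, which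
         only occurs for t = 1 and k = n 1 *)
      forall t k, 1 <= t -> k <= n t ->
        P [set w | X t w = k] =
          ('C(N t, n t)%:R^-1
           * (binz ((N t.-1)%:Z - 1 + (n t - k)%:Z) (n t - k))%:R)%R%:E
        /\ (k < N t ->
            P [set w | X t w = k] =
              ('C(n t, k)%:R / 'C(N t, k)%:R
               * ((N t - n t)%:R / (N t - k)%:R))%R%:E)
    & (* the mass function of Y_t = X_t + 1 holds for every t >= 1; for t = 1,
         where M = 0 < r, it vanishes identically on 1, .., N, so it is a
         probability law only for t >= 2 *)
      forall t, 1 <= t ->
        [/\ N t.-1 = N t - n t,
            forall kappa, 1 <= kappa <= N t ->
              P [set w | (X t w).+1 = kappa] =
                (neg_hypergeometric_pmf R (N t) (N t.-1) 1 kappa)%:E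
          & 2 <= t ->
            neg_hypergeometric P (fun w => (X t w).+1) (N t) (N t.-1) 1]].
Proof.
move=> N X K; have NS t : N t.+1 - n t.+1 = N t by rewrite /N partial_sumS addnK.
split.
(* The event is that the choices follow c; its probability is the inverse of the number of choice
   sequences, which is the number of permutations. *)
- move=> t p /(proj2 (multiset_perms_crp n t))[c vc <-].
  rewrite (proj1 (multiset_perms_crp n t)) natr_prod -prodfV.
  rewrite -(crp_joint_law _ _ _ _ _ _ _ _ _ crp vc).
  by congr (P _); apply/seteqP; split=> w /(crp_perm_choices _ _ _ _ _ _ _ _ _ _ crp vc).
- move=> t w; rewrite /K /num_cycles (crp_perm_factors _ _ _ _ _ _ _ _ _ crp).
  rewrite cycle_factorsK; last first.
    have [] // := crp_factors_invariant n t (fun u => C u.+1 w).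
    by move=> u _; apply: (crp_valid crp).
  elim: t => [|t ih]; first by rewrite big_geq.
  by rewrite big_nat_recr //= size_insert_in_factors ih.
- exact: crp_new_cycles_independent crp.
- case=> // t k _ kn; split; first exact: crp_new_cycles_law crp kn.
  by rewrite NS; apply: crp_new_cycles_closed_form crp.
case=> // t _; split; first by rewrite NS.
  by move=> kappa; apply: crp_neg_hypergeometric_pmf crp.
(* Outside 1, .., N the event is empty: X + 1 is at most n_{t+1} + 1, and N_t is positive from the
   second step on. *)
move=> t_gt0 kappa; case: ifP => kN; first exact: crp_neg_hypergeometric_pmf crp kN.
rewrite (_ : [set _ | _] = set0) ?measure0 //; apply/seteqP; split=> // w /= kE.
move: kN; rewrite -kE /= /N partial_sumS => /negbT/negP; apply.
have /andP[_ /eqP sumc] := crp_valid crp t w.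
have N_gt0 : 0 < partial_sum n t.
  case: t t_gt0 {kE sumc} => // t _.
  by rewrite partial_sumS addn_gt0 n_ge1 ?orbT.
by rewrite /X -add1n leq_add // -sumc leq_addr.
Qed.
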